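(* Let $a,b\in\mathbb{R}$ with $0<|a|<1$. Then every nonzero periodic solution of the difference equation $x_{n+1}=\dfrac{x_{n-1}}{a+bx_nx_{n-1}}$, $n\ge 0$, with real initial conditions $(x_{-1},x_0)\in\mathbb{R}^2$, is stable.
   Context: A periodic solution is a solution $\{\bar x_n\}_{n\ge -1}$, defined for all $n$, such that for some integer $m\ge1$, $\bar x_{n+m}=\bar x_n$ for all $n\ge -1$; it is nonzero if it is not identically zero. Stability is (Lyapunov) stability with respect to initial conditions: a solution $\{\bar x_n\}_{n\ge-1}$ is stable if for every $\epsilon>0$ there is $\delta>0$ such that, whenever $\max\{|x_{-1}-\bar x_{-1}|,|x_0-\bar x_0|\}<\delta$, the solution $\{x_n\}$ with initial condition $(x_{-1},x_0)$ is defined for all $n$ and satisfies $|x_n-\bar x_n|<\epsilon$ for all $n\ge -1$. *)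

(* Defs.v *)
From mathcomp Require Import all_boot all_order all_algebra.
From mathcomp Require Import reals.
Set Implicit Arguments.
Unset Strict Implicit.
Unset Printing Implicit Defensive.
Import Order.TTheory GRing.Theory Num.Theory.
Local Open Scope ring_scope.

(* A sequence {x_n}_{n >= -1} is encoded as [x : nat -> R] with the index
   shifted by one: [x k] stands for x_{k-1}, so that [x 0] and [x 1] are the
   initial conditions x_{-1} and x_0. *)

(* x_{n+1} = x_{n-1} / (a + b x_n x_{n-1}) for all n >= 0; "defined for all n"
   is the nonvanishing of every denominator (division by 0 is total here). *)
Definition is_solution (R : realType) (a b : R) (x : nat -> R) : Prop :=
  forall n : nat,
    a + b * x n.+1 * x n != 0 /\
    x n.+2 = x n / (a + b * x n.+1 * x n).

Definition is_periodic (R : realType) (x : nat -> R) : Prop :=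
  exists m : nat, (1 <= m)%N /\ forall n : nat, x (n + m)%N = x n.

Definition not_identically_zero (R : realType) (x : nat -> R) : Prop :=
  exists n : nat, x n <> 0.

(* A solution is determined by its initial conditions, so "exists y" says that
   the solution with initial conditions (u, v) is defined for all n. *)
Definition is_stable (R : realType) (a b : R) (xbar : nat -> R) : Prop :=
  forall eps : R, 0 < eps ->
  exists delta : R, 0 < delta /\
    forall u v : R,
      Num.max `|u - xbar 0%N| `|v - xbar 1%N| < delta ->
      exists y : nat -> R,
        [/\ is_solution a b y, y 0%N = u, y 1%N = v
          & forall n : nat, `|y n - xbar n| < eps].

(* Main.v *)
(** Write D_n = a + b x_n x_{n-1}, so that x_{n+1} = x_{n-1} / D_n.  The products
    P_n = x_n x_{n-1} satisfy P_{n+1} = P_n / D_n, and the defects E_n = D_n - 1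
    satisfy E_{n+1} = a E_n / D_n.  Hence E_n / P_n is a geometric sequence of
    ratio a when P_0 <> 0, and periodicity forces E_n = 0; when P_0 = 0 every
    D_n equals a and the only periodic solution is 0.  So a nonzero periodic
    solution has E_n = 0 for all n and is 2-periodic.  For nearby initial
    conditions E_0 is small, so E_n decays geometrically and the total drift
    of x_{n+1} - x_{n-1} = - x_{n-1} E_n / D_n is summable and O(E_0). *)
Require Import Defs.
From mathcomp Require Import all_boot all_order all_algebra.
From mathcomp Require Import reals.
From mathcomp Require Import ring lra.
Set Implicit Arguments.
Unset Strict Implicit.
Unset Printing Implicit Defensive.
Import Order.TTheory GRing.Theory Num.Theory.
Local Open Scope ring_scope.

(** Since [|a| < 1] and [m > 0], [a ^+ m] cannot be 1. It is applied to quantities that are both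
    geometric and [m]-periodic. *)
Lemma eq0_of_geometric (R : realDomainType) (a s : R) (m : nat) :
  `|a| < 1 -> (0 < m)%N -> s = a ^+ m * s -> s = 0.
Proof.
move=> a1 m0 sE; have /eqP : (1 - a ^+ m) * s = 0.
  by rewrite mulrBl mul1r -sE subrr.
rewrite mulf_eq0 subr_eq0 => /orP[/eqP am|/eqP //].
have := exprn_ilt1 m (normr_ge0 a) a1.
by rewrite -normrX -am normr1 ltxx -lt0n m0.
Qed.

Section Solution.
Variables (R : realType) (a b : R) (x : nat -> R).

Definition denom (n : nat) : R := a + b * x n.+1 * x n.

Lemma denom_subr1S n : denom n != 0 -> x n.+2 = x n / denom n ->
  denom n.+1 - 1 = a * (denom n - 1) / denom n.
Proof. by rewrite {3}/denom => + ->; rewrite /denom => D0; field. Qed.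

Hypothesis x_sol : is_solution a b x.

Lemma denom_neq0 n : denom n != 0.
Proof. by have [] := x_sol n. Qed.

Lemma solutionE n : x n.+2 = x n / denom n.
Proof. by have [] := x_sol n. Qed.

Lemma solution_prodS n : x n.+2 * x n.+1 = x n.+1 * x n / denom n.
Proof. by rewrite solutionE mulrAC [x n * _]mulrC. Qed.

Lemma periodic_denom_eq1 :
    0 < `|a| < 1 -> is_periodic x -> not_identically_zero x ->
  forall n, denom n = 1.
Proof.
move=> /andP[a0 a1] [m [m0 xm]] [k xk].
have [P0|P0] := eqVneq (x 1%N * x 0%N) 0.
- exfalso; apply: xk.
  have PE n : x n.+1 * x n = 0.
    by elim: n => // n IH; rewrite solution_prodS IH mul0r.
  have xE n : x n = a * x n.+2.
    rewrite solutionE /denom -mulrA PE mulr0 addr0 mulrC divfK //.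
    by rewrite -normr_gt0.
  have xkE j : x k = a ^+ j * x (k + j.*2)%N.
    elim: j => [|j IH]; first by rewrite addn0 mul1r.
    by rewrite IH xE exprSr mulrA doubleS !addnS.
  (* Each factor [a] costs two indices, so [m] factors advance by [2m], which is two periods. *)
  apply: (eq0_of_geometric a1 m0); rewrite {1}(xkE m).
  by rewrite -addnn addnA !xm.
have PN n : x n.+1 * x n != 0.
  elim: n => // n IH.
  by rewrite solution_prodS mulf_neq0 // invr_eq0 denom_neq0.
have QE n : (denom n - 1) / (x n.+1 * x n)
    = a ^+ n * ((denom 0%N - 1) / (x 1%N * x 0%N)).
  elim: n => [|n IH]; first by rewrite mul1r.
  rewrite exprS -mulrA -IH solution_prodS.
  rewrite (denom_subr1S (denom_neq0 n) (solutionE n)).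
  rewrite invfM invrK mulrA -!mulrA; congr (_ * (_ * _)).
  by rewrite mulrCA mulVf ?mulr1 // denom_neq0.
have D0 : denom 0%N = 1.
  have /eqP : (denom 0%N - 1) / (x 1%N * x 0%N) = 0.
    apply: (eq0_of_geometric a1 m0); rewrite -QE /denom.
    by rewrite -(xm 0%N) -(xm 1%N) add0n add1n.
  by rewrite mulf_eq0 invr_eq0 (negbTE P0) orbF subr_eq0 => /eqP.
elim=> // n IH; apply/eqP.
rewrite -subr_eq0 (denom_subr1S (denom_neq0 n) (solutionE n)) IH.
by rewrite subrr mulr0 mul0r.
Qed.

End Solution.

(** Carrying two consecutive terms makes the second-order recursion structural. A zero denominator
    yields 0 here, so nonvanishing has to be proved separately. *)
Fixpoint orbit_pair (R : realType) (a b u v : R) (n : nat) : R * R :=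
  if n is n'.+1 then
    let: (p, q) := orbit_pair a b u v n' in (q, p / (a + b * q * p))
  else (u, v).

Definition orbit_of (R : realType) (a b u v : R) (n : nat) : R :=
  (orbit_pair a b u v n).1.

Lemma orbit_ofSS (R : realType) (a b u v : R) (n : nat) :
  let y := orbit_of a b u v in y n.+2 = y n / denom a b y n.
Proof. by rewrite /denom /orbit_of /=; case: orbit_pair. Qed.

Section Perturbation.
Variables (R : realType) (a b : R) (y : nat -> R).

Let D := denom a b y.
Let e : R := `|D 0%N - 1|.
(* |a| / |D_n| <= r as soon as |D_n - 1| <= (1 - |a|) / 2. *)
Let r : R := `|a| * 2 / (1 + `|a|).

Lemma ratio_bounds : `|a| < 1 -> 0 <= r < 1.
Proof.
move=> a1.
have a0 := normr_ge0 a.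
have p : 0 < 1 + `|a| by lra.
apply/andP; split; last by rewrite ltr_pdivrMr; lra.
by rewrite divr_ge0 ?mulr_ge0 //; lra.
Qed.

(** The threshold puts [d] above [(1 + |a|) / 2], the midpoint of [|a|] and 1, so dividing [a] by
    [d] still gives a contraction. *)
Lemma near1_inv (d : R) :
  `|a| < 1 -> `|d - 1| <= (1 - `|a|) / 2 -> d != 0 /\ `|d^-1| <= 2 / (1 + `|a|).
Proof.
move=> a1 hd; have a0 := normr_ge0 a.
have dge : (1 + `|a|) / 2 <= d by move: hd; rewrite ler_norml => /andP[]; lra.
have d0 : 0 < d by lra.
split; first by rewrite gt_eqF.
rewrite gtr0_norm ?invr_gt0 // -[2 / _]invrK invf_div lef_pV2 ?posrE //; lra.
Qed.

Hypothesis a1 : `|a| < 1.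
Hypothesis yE : forall n, y n.+2 = y n / D n.
Hypothesis e_small : e <= (1 - `|a|) / 2.

(** The bound at [n] keeps [D n] within the threshold of [near1_inv], because [r ^+ n <= 1]; the
    next defect then shrinks by a factor [r] or better. *)
Lemma denom_decay n : `|D n - 1| <= r ^+ n * e.
Proof.
have /andP[r0 r1] := ratio_bounds a1.
have e0 : 0 <= e by exact: normr_ge0.
elim: n => [|n IH]; first by rewrite mul1r.
have [Dn0 Dn] : D n != 0 /\ `|(D n)^-1| <= 2 / (1 + `|a|).
  apply: near1_inv => //; apply: le_trans e_small; apply: le_trans IH _.
  by rewrite ler_piMl // exprn_ile1 // ltW.
have -> : D n.+1 - 1 = a * (D n - 1) / D n.
  exact: denom_subr1S.
rewrite !normrM exprS -mulrA.
have -> : r * r ^+ n * e = `|a| * ((r ^+ n * e) * (2 / (1 + `|a|))).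
  by rewrite /r; ring.
by rewrite ler_wpM2l // ler_pM.
Qed.

Lemma denom_near1 n : D n != 0 /\ `|(D n)^-1| <= 2.
Proof.
have /andP[r0 r1] := ratio_bounds a1.
have [|D0 Dn] := near1_inv (d := D n) a1.
  apply: le_trans e_small; apply: le_trans (denom_decay n) _.
  by rewrite ler_piMl ?normr_ge0 // exprn_ile1 // ltW.
split=> //; apply: le_trans Dn _.
have a0 := normr_ge0 a.
by rewrite ler_pdivrMr; lra.
Qed.

(** A bootstrap: while [y] stays within 1 of [z], [|y n| <= M], so each two-step increment is at
    most [2 * M * e * r ^+ n]. The geometric series of these bounds sums to a total that the last
    hypothesis keeps within 1. *)
Lemma perturbed_near_periodic (z : nat -> R) (M delta : R) :
    (forall n, z n.+2 = z n) -> (forall n, `|z n| + 1 <= M) ->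
    `|y 0%N - z 0%N| <= delta -> `|y 1%N - z 1%N| <= delta ->
    delta + 2 * M * e / (1 - r) <= 1 ->
  forall n, `|y n - z n| <= delta + 2 * M * e / (1 - r).
Proof.
move=> zE zM h0 h1 hle.
have /andP[r0 r1] := ratio_bounds a1.
have M0 : 0 <= M by have := zM 0%N; have := normr_ge0 (z 0%N); lra.
have e0 : 0 <= e by exact: normr_ge0.
set c : R := 2 * M * e / (1 - r) in hle *.
have c0 : 0 <= c by rewrite divr_ge0 ?mulr_ge0 // subr_ge0 ltW.
have cr : c * (1 - r) = 2 * M * e.
  by rewrite divfK // subr_eq0 gt_eqF.
have rn n : 0 <= r ^+ n <= 1 by rewrite exprn_ge0 ?exprn_ile1 // ltW.
suff H n : `|y n - z n| <= delta + c * (1 - r ^+ n)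
        /\ `|y n.+1 - z n.+1| <= delta + c * (1 - r ^+ n.+1).
  move=> n; apply: le_trans (H n).1 _.
  by rewrite lerD2l ler_piMr //; have := rn n; lra.
elim: n => [|n [IH IH']].
  rewrite expr0 subrr mulr0 addr0 expr1; split=> //.
  by apply: le_trans h1 _; rewrite lerDl mulr_ge0 // subr_ge0 ltW.
split=> //.
have yn : `|y n| <= M.
  have cn : c * (1 - r ^+ n) <= c by rewrite ler_piMr //; have := rn n; lra.
  have := ler_normD (y n - z n) (z n); rewrite subrK.
  by have := zM n; lra.
have [Dn0 Dn] := denom_near1 n.
have -> : y n.+2 - z n.+2 = (y n - z n) - y n * ((D n - 1) / D n).
  by rewrite yE zE; field.
have step : `|y n * ((D n - 1) / D n)| <= M * (r ^+ n * e * 2).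
  rewrite !normrM ler_pM ?mulr_ge0 // ler_pM //; exact: denom_decay.
apply: le_trans (ler_normB _ _) _.
(* In this form the increment telescopes against the invariant, giving exponent [n.+1]; passing to
   [n.+2] only weakens the bound. *)
have E : M * (r ^+ n * e * 2) = c * (r ^+ n - r ^+ n.+1).
  transitivity (2 * M * e * r ^+ n); first by ring.
  by rewrite -cr exprS; ring.
have : c * (r ^+ n.+2) <= c * r ^+ n.+1.
  by rewrite ler_wpM2l // exprS ler_piMl ?exprn_ge0 // ltW.
rewrite E in step; lra.
Qed.

End Perturbation.

Theorem theorem5p5 (R : realType) (a b : R) (ha : 0 < `|a| < 1)
  (xbar : nat -> R) (hsol : is_solution a b xbar)
  (hper : is_periodic xbar) (hnz : not_identically_zero xbar) :
  is_stable a b xbar.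
Proof.
have D1 := periodic_denom_eq1 hsol ha hper hnz.
have xE n : xbar n.+2 = xbar n by rewrite (solutionE hsol) D1 divr1.
have /andP[a0 a1] := ha.
pose M : R := `|xbar 0%N| + `|xbar 1%N| + 1.
have p0 := normr_ge0 (xbar 0%N); have q0 := normr_ge0 (xbar 1%N).
have M1 : 1 <= M by rewrite /M; lra.
have xM n : `|xbar n| + 1 <= M.
  suff [] : `|xbar n| + 1 <= M /\ `|xbar n.+1| + 1 <= M by [].
  elim: n => [|n [IH IH']]; first by rewrite /M; split; lra.
  by rewrite xE.
pose r : R := `|a| * 2 / (1 + `|a|).
have /andP[r0 r1] : 0 <= r < 1 by exact: ratio_bounds a1.
have r1a : 1 - r <= 1 - `|a|.
  by rewrite lerD2l lerN2 /r -mulrA ler_peMr // ler_pdivlMr; lra.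
(* [L] is such that an initial defect of at most [2 * M * |b| * delta] causes a total drift of at
   most [delta * L]. *)
pose L : R := 4 * M * M * `|b| / (1 - r).
have L0 : 0 <= L by rewrite divr_ge0 ?mulr_ge0 //; lra.
have LE : L * (1 - r) = 4 * M * M * `|b| by rewrite divfK // subr_eq0 gt_eqF.
(* The bound 1 serves the bootstrap; [eps / 2] makes the final inequality strict. *)
move=> eps eps0; pose eta : R := Num.min (eps / 2) 1.
have eta0 : 0 < eta by rewrite lt_min ltr01 andbT; lra.
pose delta : R := eta / (1 + L).
have delta0 : 0 < delta by rewrite divr_gt0 //; lra.
have deltaE : delta + delta * L = eta.
  by rewrite -[X in X + _]mulr1 -mulrDr divfK // gt_eqF //; lra.
have [eta1 eta_eps] : eta <= 1 /\ eta < eps.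
  rewrite /eta ge_min lexx orbT gt_min; split=> //.
  by apply/orP; left; lra.
exists delta; split=> // u v.
rewrite gt_max => /andP[/ltW hu /ltW hv].
pose y := orbit_of a b u v.
have yE n : y n.+2 = y n / denom a b y n by exact: orbit_ofSS.
have eM : `|denom a b y 0%N - 1| <= 2 * M * `|b| * delta.
  (* The 1 is replaced by the initial denominator of [xbar], leaving a difference of products. *)
  have -> : denom a b y 0%N - 1
      = b * ((v - xbar 1%N) * u + xbar 1%N * (u - xbar 0%N)).
    by rewrite -{1}(D1 0%N) /denom /y /orbit_of /=; ring.
  have uM : `|u| <= M.
    have := ler_normD (u - xbar 0%N) (xbar 0%N); rewrite subrK.
    have dL : 0 <= delta * L by rewrite mulr_ge0 // ltW.
    by have := xM 0%N; lra.
  have qM : `|xbar 1%N| <= M by have := xM 1%N; lra.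
  rewrite normrM.
  have -> : 2 * M * `|b| * delta = `|b| * (delta * M + M * delta) by ring.
  rewrite ler_wpM2l //; apply: le_trans (ler_normD _ _) _.
  by rewrite !normrM lerD // ler_pM.
have eL : 2 * M * `|denom a b y 0%N - 1| / (1 - r) <= delta * L.
  rewrite ler_pdivrMr; last by lra.
  rewrite -(mulrA delta) LE.
  have -> : delta * (4 * M * M * `|b|) = 2 * M * (2 * M * `|b| * delta) by ring.
  by rewrite ler_wpM2l // mulr_ge0 //; lra.
have e_small : `|denom a b y 0%N - 1| <= (1 - `|a|) / 2.
  (* With [M >= 1] and [1 - r <= 1 - |a|], this gives the required threshold. *)
  have h : 2 * M * `|denom a b y 0%N - 1| <= 1 - r.
    have r1' : 0 < 1 - r by lra.
    rewrite -[X in _ <= X]mul1r -ler_pdivrMr //.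
    by apply: le_trans eL _; lra.
  have : 1 * `|denom a b y 0%N - 1| <= M * `|denom a b y 0%N - 1|.
    by rewrite ler_wpM2r.
  rewrite -mulrA in h; lra.
exists y; split=> // [n|n].
  by have [Dn0 _] := denom_near1 a1 yE e_small n; split=> //; exact: yE.
apply: le_lt_trans (perturbed_near_periodic a1 yE e_small xE xM hu hv _ n) _.
  by rewrite -/r; lra.
by rewrite -/r; lra.
Qed.
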